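(* Let $K,L$ be based topological spaces and let $A$ be an abelian topological monoid. There are the following natural identifications in the category $\mathcal{A}b$ of abelian topological monoids: (1) $SP^\infty(K,A)=K\otimes A$; (2) $SP^\infty(S^0,A)=A$; (3) $SP^\infty(K\wedge L,A)=SP^\infty(K,SP^\infty(L,A))$; (4) $SP^\infty(K\vee L,A)=SP^\infty(K,A)\times SP^\infty(L,A)$.
   Context: $\mathcal T$ is the category of based topological spaces. $\mathcal{A}b$ is the category of abelian topological monoids, regarded as enriched over $\mathcal T$, with $\mathrm{Map}_{\mathcal{A}b}(A,B)$ the based space of monoid maps from $A$ to $B$ inside $\mathrm{Map}_{\mathcal T}(A,B)$. The tensor product $K\otimes A\in\mathcal{A}b$ of $K\in\mathcal T$ with $A\in\mathcal{A}b$ is the object satisfying $\mathrm{Map}_{\mathcal{A}b}(K\otimes A,B)=\mathrm{Map}_{\mathcal T}(K,\mathrm{Map}_{\mathcal{A}b}(A,B))$ for all $B\in\mathcal{A}b$. For $K\in\mathcal T$ with basepoint $*$ and $A\in\mathcal{A}b$, $SP^\infty(K,A)$ is the abelian topological monoid with generators $k^a$, for $k\in K$ and $a\in A$, subject to the relations: (i) $*^a=*$ for all $a\in A$; (ii) $k^0=*$ for all $k\in K$; (iii) $k^{a_1}k^{a_2}=k^{a_1+a_2}$ for all $a_1,a_2\in A$ (and $k\in K$). Here $*$ on the right-hand sides is the unit of $SP^\infty(K,A)$. Viewing $k^a$ as an element of $K\times A$, $SP^\infty(K,A)$ is topologized as the evident quotient space of $\coprod_{d=0}^{\infty}(K\times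 A)^d$.
   Formalization: Based topological spaces and abelian topological monoids are taken to be compactly generated (k-spaces, no separation axiom), with products and mapping spaces k-ified; for arbitrary spaces, addition on SP^∞(K,A) need not be continuous. *)

(* Defs.v *)
(* "Based topological space" is read in the convenient category of k-spaces
   (compactly generated spaces, with no separation axiom imposed): in the
   category of all topological spaces there is in general no exponential law
   Map(K, Map(L, X)) = Map(K /\ L, X), and a product of two quotient maps need
   not be a quotient map. Products, mapping spaces and subspaces are therefore
   k-ified; coproducts and quotients of k-spaces are already k-spaces. *)
From HB Require Import structures.
From mathcomp Require Import all_boot all_order all_algebra all_classical.
From mathcomp Require Import topology wedge_sigT.

Set Implicit Arguments.
Unset Strict Implicit.
Unset Printing Implicit Defensive.
Import GRing.Theory.
Local Open Scope classical_set_scope.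
Local Open Scope ring_scope.
Local Open Scope quotient_scope.

(* U is k-open when its inverse image along every map from a compact Hausdorff
   space is open. *)
Definition kopen (X : topologicalType) : set (set X) :=
  [set U | forall (C : topologicalType) (u : C -> X),
     compact [set: C] -> hausdorff_space C -> continuous u ->
     open (u @^-1` U)].

HB.mixin Record isKSpace X & Topological X := {
  kopen_open : forall U : set X, @kopen X U -> open U
}.

#[short(type="kspaceType")]
HB.structure Definition KSpace := {X of Topological X & isKSpace X}.

#[short(type="basedType")]
HB.structure Definition Based := {X of KSpace X & Pointed X}.

(* The type X, with the k-open sets of X as its open sets. *)
Definition kify (X : Type) : Type := X.

Section kify.
Variable X : topologicalType.

Let kopenT : kopen [set: X].
Proof. by move=> C u _ _ _; rewrite preimage_setT; exact: openT. Qed.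

Let kopenI : setI_closed (@kopen X).
Proof.
move=> U V kU kV C u cC hC cu; rewrite preimage_setI.
by apply: openI; [exact: kU | exact: kV].
Qed.

Let kopen_bigcup (I : Type) (f : I -> set X) :
  (forall i, kopen (f i)) -> kopen (\bigcup_i f i).
Proof.
move=> kf C u cC hC cu; rewrite preimage_bigcup.
by apply: bigcup_open => i _; exact: kf.
Qed.

HB.instance Definition _ := Choice.on (kify X).
HB.instance Definition _ :=
  isOpenTopological.Build (kify X) kopenT kopenI kopen_bigcup.

Lemma kify_openE (U : set X) : @open (kify X) U = kopen U.
Proof. by []. Qed.

Lemma kify_test (C : topologicalType) (u : C -> X) :
  compact [set: C] -> hausdorff_space C -> continuous u ->
  continuous (u : C -> kify X).
Proof.
move=> cC hC cu; apply/continuousP => U.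
by rewrite kify_openE => kU; exact: kU.
Qed.

Lemma kify_id_continuous : continuous (idfun : kify X -> X).
Proof.
apply/continuousP => U oU; rewrite kify_openE => C u _ _ /continuousP cu.
exact: cu.
Qed.

Let kify_kspace (U : set (kify X)) : @kopen (kify X) U -> open U.
Proof.
move=> kU; rewrite kify_openE => C u cC hC cu.
by apply: kU => //; exact: kify_test.
Qed.

HB.instance Definition _ := isKSpace.Build (kify X) kify_kspace.
End kify.

HB.instance Definition _ (X : pointedType) := Pointed.copy (kify X) X.
HB.instance Definition _ (X : ptopologicalType) := Pointed.on (kify X).
HB.instance Definition _ (X Y : ptopologicalType) := Pointed.on (X * Y)%type.
HB.instance Definition _ (A : nmodType) := GRing.Nmodule.copy (kify A) A.

HB.mixin Record isAbMonoid A & GRing.Nmodule A & Based A := {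
  kadd_continuous :
    continuous ((fun x => x.1 + x.2) : kify (A * A)%type -> A);
  point0 : point = 0 :> A
}.
#[short(type="abMonType")]
HB.structure Definition AbMon :=
  {A of GRing.Nmodule A & Based A & isAbMonoid A}.

Lemma kspace_continuous (X : kspaceType) (Y : topologicalType) (f : X -> Y) :
  (forall (C : topologicalType) (u : C -> X), compact [set: C] ->
    hausdorff_space C -> continuous u -> continuous (f \o u)) ->
  continuous f.
Proof.
move=> cf; apply/continuousP => V oV; apply: kopen_open => C u cC hC cu.
by rewrite -comp_preimage; move/continuousP : (cf C u cC hC cu); apply.
Qed.

Lemma kify_continuous (X : kspaceType) (Y : topologicalType) (f : X -> Y) :
  continuous f -> continuous (f : X -> kify Y).
Proof.
move=> cf; apply: kspace_continuous => C u cC hC cu; apply: kify_test => //.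
by move=> c; apply: continuous_comp; [exact: cu | exact: cf].
Qed.

Lemma kify_continuousD (Y Z : topologicalType) (f : Y -> Z) :
  continuous f -> continuous (f : kify Y -> Z).
Proof.
move=> cf x; apply: (@continuous_comp _ _ _ (idfun : kify Y -> Y)).
  exact: kify_id_continuous.
exact: cf.
Qed.

Lemma compT (R S T : topologicalType) (f : R -> S) (g : S -> T) :
  continuous f -> continuous g -> continuous (g \o f).
Proof. by move=> cf cg x; apply: continuous_comp; [exact: cf|exact: cg]. Qed.

Lemma pair_continuous (R S T : topologicalType) (f : R -> S) (g : R -> T) :
  continuous f -> continuous g -> continuous (fun x => (f x, g x)).
Proof. by move=> cf cg x; apply: cvg_pair; [exact: cf|exact: cg]. Qed.

Lemma kpair_continuous (R : kspaceType) (S T : topologicalType)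
    (f : R -> S) (g : R -> T) :
  continuous f -> continuous g ->
  continuous ((fun x => (f x, g x)) : R -> kify (S * T)%type).
Proof. by move=> cf cg; apply: kify_continuous; exact: pair_continuous. Qed.

Lemma kfst_continuous (S T : topologicalType) :
  continuous (fst : kify (S * T)%type -> S).
Proof. by apply: kify_continuousD => x; exact: cvg_fst. Qed.

Lemma ksnd_continuous (S T : topologicalType) :
  continuous (snd : kify (S * T)%type -> T).
Proof. by apply: kify_continuousD => x; exact: cvg_snd. Qed.

Section quotient.
Variables (X : kspaceType) (Q0 : quotType X).
Local Notation Q := (quotient_topology Q0).
Let quotient_kspace (U : set Q) : kopen U -> open U.
Proof.
move=> kU; rewrite /open/= /quotient_open; apply: kopen_open => C u cC hC cu.
rewrite -comp_preimage; apply: kU => //.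
by apply: compT => //; exact: pi_continuous.
Qed.
HB.instance Definition _ := isKSpace.Build Q quotient_kspace.
End quotient.

Section sigT.
Variables (I : choiceType) (X : I -> kspaceType).
Let sigT_kspace (U : set {i & X i}) : kopen U -> open U.
Proof.
move=> kU; apply/sigT_openP => i; apply: kopen_open => C u cC hC cu.
rewrite -comp_preimage; apply: kU => //.
by apply: compT => //; exact: existT_continuous.
Qed.
HB.instance Definition _ := isKSpace.Build {i & X i} sigT_kspace.
End sigT.

Lemma bool_kspace (U : set bool) : kopen U -> open U.
Proof. by move=> _; exact: discrete_open. Qed.
HB.instance Definition _ := isKSpace.Build bool bool_kspace.

Lemma hausdorff_pair (S T : topologicalType) :
  hausdorff_space S -> hausdorff_space T -> hausdorff_space (S * T)%type.
Proof.
have nX (p : S * T) U V : nbhs p.1 U -> nbhs p.2 V -> nbhs p (U `*` V).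
  by move=> pU pV; exists (U, V).
move=> hS hT p q cl; rewrite [p]surjective_pairing [q]surjective_pairing.
congr pair.
- apply: hS => U V Up Vq.
  have [[x y] [/= [Ux _] [Vx _]]] := cl _ _ (nX _ _ _ Up filterT)
    (nX _ _ _ Vq filterT).
  by exists x.
- apply: hT => U V Up Vq.
  have [[x y] [/= [_ Uy] [_ Vy]]] := cl _ _ (nX _ _ _ filterT Up)
    (nX _ _ _ filterT Vq).
  by exists y.
Qed.

Lemma kprod_quotientl (X Y : kspaceType) (Q0 : quotType X)
    (Z : topologicalType) (h : kify (quotient_topology Q0 * Y)%type -> Z) :
  continuous ((fun p => h (\pi_(quotient_topology Q0) p.1, p.2)) :
    kify (X * Y)%type -> Z) ->
  continuous h.
Proof.
move=> ch; apply/continuousP => V oV; apply: kopen_open => C w cC hC cw.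
pose Q := quotient_topology Q0.
pose O := [set p : X * C | V (h (\pi_Q p.1, (w p.2).2))].
have ks (D : topologicalType) (t : D -> X * C) : compact [set: D] ->
    hausdorff_space D -> continuous t -> open (t @^-1` O).
  move=> cD hD ct.
  pose t' : D -> kify (X * Y)%type := fun d => ((t d).1, (w (t d).2).2).
  have ct' : continuous t'.
    have c1 : continuous (fun d => (t d).1).
      by apply: (compT ct) => x; exact: cvg_fst.
    have c2 : continuous (fun d => (t d).2).
      by apply: (compT ct) => x; exact: cvg_snd.
    apply: kify_test => //; apply: pair_continuous => //.
    exact: (compT (compT c2 cw) (@ksnd_continuous _ _)).
  by move/continuousP : (compT ct' ch); apply.
rewrite openE => c0 /= Vc0.
case wc0 : (w c0) => [q0 y0]; pose x0 : X := repr q0.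
have Ox0 : O (x0, c0).
  by rewrite /O/= /x0 reprK; move: Vc0; rewrite /= wc0.
have oS : open [set c | O (x0, c)].
  apply: (ks C (fun c => (x0, c))) => //.
  by apply: pair_continuous => // c; [exact: cvg_cst | exact: cvg_id].
have [N [Nc0 cN NO]] : exists N : set C,
    [/\ nbhs c0 N, closed N & N `<=` [set c | O (x0, c)]].
  have /(_ _) := @compact_regular C c0 setT hC cC.
  have nT : nbhs c0 [set: C] by exact: filterT.
  have nO : nbhs c0 [set c | O (x0, c)] by exact: open_nbhs_nbhs.
  move=> /(_ nT _ nO)[N Nc0 cNO].
  exists (closure N); split; last exact: cNO.
    by apply: filterS Nc0; exact: subset_closure.
  exact: closed_closure.
have cptN : compact N by apply: (subclosed_compact cN cC).
pose W := [set q : Q | forall c, N c -> V (h (q, (w c).2))].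
have oW : open W.
  rewrite /open/= /quotient_open; apply: kopen_open => D t cD hD ct.
  have oO' : open [set p : D * C | O (t p.1, p.2)].
    apply: (ks (D * C)%type (fun p => (t p.1, p.2))).
    - by rewrite -setXTT; exact: compact_setX.
    - exact: hausdorff_pair.
    - apply: pair_continuous; last by move=> x; exact: cvg_snd.
      by apply: (@compT _ _ _ fst t) => // x; exact: cvg_fst.
  rewrite openE => d /= Wd; rewrite /interior.
  have := cptN; rewrite compact_near_coveringP => /(_ D (nbhs d)
    (fun d' c => V (h (\pi_Q (t d'), (w c).2)))).
  apply => c Nc.
  have : nbhs (d, c) [set p : D * C | O (t p.1, p.2)].
    by apply: open_nbhs_nbhs; split => //; exact: Wd.
  case=> -[A B] /= [Ad Bc] AB; exists (B, A) => //= -[c' d'] /= [Bc' Ad'].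
  exact: (AB (d', c')).
have Wq0 : W q0.
  by move=> c Nc; have := NO _ Nc; rewrite /O/= /x0 reprK.
have : nbhs c0 ((fst \o w) @^-1` W).
  have cf : continuous (fst \o w : C -> Q).
    exact: (compT cw (@kfst_continuous _ _)).
  by apply: cf; apply: open_nbhs_nbhs; split => //=; rewrite wc0.
move=> nW; rewrite /interior; apply: filterS (filterI nW Nc0) => c [/= Wc Nc].
by have := Wc c Nc; case: (w c).
Qed.

Lemma kswap_continuous (X Y : topologicalType) :
  continuous ((fun p => (p.2, p.1)) : kify (X * Y)%type -> kify (Y * X)%type).
Proof.
by apply: kpair_continuous; [exact: ksnd_continuous | exact: kfst_continuous].
Qed.

Lemma kprod_quotientr (X Y : kspaceType) (Q0 : quotType X)
    (Z : topologicalType) (h : kify (Y * quotient_topology Q0)%type -> Z) :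
  continuous ((fun p => h (p.1, \pi_(quotient_topology Q0) p.2)) :
    kify (Y * X)%type -> Z) ->
  continuous h.
Proof.
move=> ch.
have -> : h = (fun p => h (p.2, p.1)) \o (fun p => (p.2, p.1)).
  by apply/funext => -[].
apply: (@compT _ (kify (quotient_topology Q0 * Y)%type)).
  exact: kswap_continuous.
apply: kprod_quotientl.
by have := compT (@kswap_continuous X Y) ch; apply.
Qed.

Record bmap (X Y : basedType) := BMap {
  bmap_fun :> X -> Y;
  bmap_continuous : continuous bmap_fun;
  bmap_point : bmap_fun point = point
}.

HB.instance Definition _ (X Y : basedType) := gen_eqMixin (bmap X Y).
HB.instance Definition _ (X Y : basedType) := gen_choiceMixin (bmap X Y).

(* Without separation axioms the compact-open topology has to be tested on maps
   u : C -> X from compact Hausdorff spaces rather than on compact subsets. *)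
Definition bmap_subbase (X Y : basedType) : set (set (bmap X Y)) :=
  [set W | exists (C : topologicalType) (u : C -> X) (V : set Y),
     [/\ compact [set: C], hausdorff_space C, continuous u, open V &
         W = [set f : bmap X Y | forall c, V (f (u c))]]].

Definition compact_open_bmap (X Y : basedType) : Type := bmap X Y.
HB.instance Definition _ (X Y : basedType) :=
  Choice.on (compact_open_bmap X Y).
HB.instance Definition _ (X Y : basedType) :=
  isSubBaseTopological.Build (compact_open_bmap X Y)
    (@bmap_subbase X Y) id.

HB.instance Definition _ (X Y : basedType) :=
  KSpace.copy (bmap X Y) (kify (compact_open_bmap X Y)).

Definition bmap_cst (X Y : basedType) : bmap X Y :=
  @BMap X Y (fun=> point) (fun _ => cvg_cst point) erefl.
HB.instance Definition _ (X Y : basedType) :=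
  isPointed.Build (bmap X Y) (bmap_cst X Y).

Record abmap (A B : abMonType) := AbMap {
  abmap_bmap :> bmap A B;
  abmap_nmod : nmod_morphism abmap_bmap
}.

HB.instance Definition _ (A B : abMonType) := gen_eqMixin (abmap A B).
HB.instance Definition _ (A B : abMonType) := gen_choiceMixin (abmap A B).

HB.instance Definition _ (A B : abMonType) :=
  KSpace.copy (abmap A B) (kify (initial_topology (@abmap_bmap A B))).

Lemma bmap_cst_nmod (A B : abMonType) : nmod_morphism (bmap_cst A B).
Proof. by split => [|x y] /=; rewrite point0 ?addr0. Qed.
HB.instance Definition _ (A B : abMonType) :=
  isPointed.Build (abmap A B) (AbMap (bmap_cst_nmod A B)).


Definition bmap_id (X : basedType) : bmap X X :=
  @BMap X X idfun (fun _ => cvg_id) erefl.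

Lemma abmap_comp_nmod (A B C : abMonType) (g : abmap B C) (f : abmap A B) :
  nmod_morphism (g \o f).
Proof.
split => [|x y] /=; first by rewrite (abmap_nmod f).1 (abmap_nmod g).1.
by rewrite (abmap_nmod f).2 (abmap_nmod g).2.
Qed.

Lemma bmap_comp_point (X Y Z : basedType) (g : bmap Y Z) (f : bmap X Y) :
  (g \o f) point = point.
Proof. by rewrite /= !bmap_point. Qed.

Definition bmap_comp (X Y Z : basedType) (g : bmap Y Z) (f : bmap X Y) :=
  BMap (compT (@bmap_continuous _ _ f) (@bmap_continuous _ _ g))
       (bmap_comp_point g f).

Definition abmap_comp (A B C : abMonType) (g : abmap B C) (f : abmap A B) :
  abmap A C := @AbMap A C (bmap_comp g f) (abmap_comp_nmod g f).

Section abprod.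
Variables A B : abMonType.
Let P := kify (A * B)%type.
Let abprod_add : continuous ((fun x => x.1 + x.2) : kify (P * P)%type -> P).
Proof.
have c1 : continuous ((fun x => (x.1.1, x.2.1)) :
    kify (P * P)%type -> kify (A * A)%type).
  apply: kpair_continuous.
    exact: (compT (@kfst_continuous P P) (@kfst_continuous A B)).
  exact: (compT (@ksnd_continuous P P) (@kfst_continuous A B)).
have c2 : continuous ((fun x => (x.1.2, x.2.2)) :
    kify (P * P)%type -> kify (B * B)%type).
  apply: kpair_continuous.
    exact: (compT (@kfst_continuous P P) (@ksnd_continuous A B)).
  exact: (compT (@ksnd_continuous P P) (@ksnd_continuous A B)).
exact: (kpair_continuous (compT c1 (@kadd_continuous A))
                        (compT c2 (@kadd_continuous B))).
Qed.
Let abprod_point0 : point = 0 :> P.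
Proof. by congr pair; exact: point0. Qed.
HB.instance Definition _ := isAbMonoid.Build (kify (A * B)%type)
  abprod_add abprod_point0.
End abprod.

HB.instance Definition _ (X : basedType) (Q : quotType X) :=
  Pointed.on (quotient_topology Q).

Section smash.
Variables K L : basedType.

Definition in_axes (x : kify (K * L)%type) : bool :=
  (x.1 == point) || (x.2 == point).

Definition smash_rel (x y : kify (K * L)%type) : bool :=
  (x == y) || (in_axes x && in_axes y).

Let smash_refl : reflexive smash_rel.
Proof. by move=> x; rewrite /smash_rel eqxx. Qed.
Let smash_sym : symmetric smash_rel.
Proof. by move=> x y; rewrite /smash_rel eq_sym andbC. Qed.
Let smash_trans : transitive smash_rel.
Proof.
rewrite /smash_rel => y x z /orP[/eqP-> //|/andP[ax ay]].
by case/orP => [/eqP <-|/andP[_ az]]; rewrite ?ax ?ay ?az orbT.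
Qed.
Definition smash_equiv := EquivRel smash_rel smash_refl smash_sym smash_trans.
Definition smash : Type := quotient_topology {eq_quot smash_equiv}.
HB.instance Definition _ := Based.on smash.
HB.instance Definition _ := Quotient.on smash.
Definition smash_pair (k : K) (l : L) : smash := \pi_smash (k, l).
End smash.

Section smash_map.
Variables (K K' L L' : basedType) (g : bmap K K') (h : bmap L L').
Let f (x : kify (K * L)%type) : smash K' L' := smash_pair (g x.1) (h x.2).
Definition smash_map_fun : smash K L -> smash K' L' := f \o repr.

Lemma smash_map_funE k l :
  smash_map_fun (smash_pair k l) = smash_pair (g k) (h l).
Proof.
rewrite /smash_map_fun /=; case: piP => -[k' l'] /eqmodP.
rewrite /= /smash_rel /in_axes /= => /predU1P[[-> ->] //|/andP[a b]].
apply/eqmodP; rewrite /= /smash_rel /in_axes /=; apply/orP; right.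
by apply/andP; split; [move: b|move: a] => /orP[/eqP->|/eqP->];
  rewrite bmap_point eqxx ?orbT.
Qed.

Let cont : continuous smash_map_fun.
Proof.
apply/quotient_continuous.
have -> : smash_map_fun \o \pi_(smash K L) = f.
  by apply/funext => -[k l]; exact: smash_map_funE.
have cg : continuous ((fun x => (g x.1, h x.2)) :
    kify (K * L)%type -> kify (K' * L')%type).
  apply: kpair_continuous.
    exact: (compT (@kfst_continuous _ _) (@bmap_continuous _ _ g)).
  exact: (compT (@ksnd_continuous _ _) (@bmap_continuous _ _ h)).
exact: (compT cg (@pi_continuous _ {eq_quot smash_equiv K' L'})).
Qed.

Let pt : smash_map_fun point = point.
Proof. by rewrite (smash_map_funE point point) !bmap_point. Qed.

Definition smash_map : bmap (smash K L) (smash K' L') := BMap cont pt.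
End smash_map.

(* S^0 is bool: the discrete two-point space, with base point false. *)
Notation S0 := bool (only parsing).

Section wedge_sum.
Variables K L : basedType.
Definition wedge_sum : Type :=
  pwedge (fun b : bool => if b then K else L : ptopologicalType).
HB.instance Definition _ := PointedTopological.on wedge_sum.
Let wedge_sum_kspace (U : set wedge_sum) : kopen U -> open U.
Proof.
move=> kU; apply/wedge_openP => i.
have cl : continuous (@wedge_lift bool _ (fun b => @point
  (if b then K else L : ptopologicalType)) i) by exact: wedge_lift_continuous.
case: i cl => cl; apply: kopen_open => C u cC hC cu;
  rewrite -comp_preimage; apply: kU => //; exact: (compT cu cl).
Qed.
HB.instance Definition _ := isKSpace.Build wedge_sum wedge_sum_kspace.
Definition wedge_inl (k : K) : wedge_sum := @wedge_lift bool _ _ true k.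
Definition wedge_inr (l : L) : wedge_sum := @wedge_lift bool _ _ false l.

Lemma wedge_inl_continuous : continuous wedge_inl.
Proof.
exact: (@wedge_lift_continuous bool
  (fun b => if b then K else L : ptopologicalType) (fun=> point) true).
Qed.

Lemma wedge_inr_continuous : continuous wedge_inr.
Proof.
exact: (@wedge_lift_continuous bool
  (fun b => if b then K else L : ptopologicalType) (fun=> point) false).
Qed.
End wedge_sum.

Section wedge_map.
Variables (K K' L L' : basedType) (g : bmap K K') (h : bmap L L').
Definition wedge_map_fun : wedge_sum K L -> wedge_sum K' L' :=
  wedge_fun (fun b => match b return (if b then K else L) -> wedge_sum K' L' with
                      | true => fun k => wedge_inl L' (g k)
                      | false => fun l => wedge_inr K' (h l)
                      end).

Let wedge_agree (i j : bool) :
  (match i return (if i then K else L) -> wedge_sum K' L' with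
   | true => fun k => wedge_inl L' (g k)
   | false => fun l => wedge_inr K' (h l) end) point =
  (match j return (if j then K else L) -> wedge_sum K' L' with
   | true => fun k => wedge_inl L' (g k)
   | false => fun l => wedge_inr K' (h l) end) point.
Proof.
have E : wedge_inl L' (g point) = wedge_inr K' (h point).
  by rewrite !bmap_point; exact: (@wedge_liftE bool (fun b => if b then K' else L' : ptopologicalType)
    (fun=> point) false point true point).
case: i; case: j; [by []| exact: E | exact: (esym E) | by []].
Qed.

Let cont : continuous wedge_map_fun.
Proof.
apply: wedge_fun_continuous; [|exact: wedge_agree].
case.
  exact: (compT (@bmap_continuous _ _ g) (@wedge_inl_continuous K' L')).
exact: (compT (@bmap_continuous _ _ h) (@wedge_inr_continuous K' L')).
Qed.

Lemma wedge_map_inl k : wedge_map_fun (wedge_inl L k) = wedge_inl L' (g k).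
Proof. by rewrite /wedge_map_fun /wedge_inl wedge_lift_funE. Qed.

Lemma wedge_map_inr l : wedge_map_fun (wedge_inr K l) = wedge_inr K' (h l).
Proof. by rewrite /wedge_map_fun /wedge_inr wedge_lift_funE. Qed.

Let pt : wedge_map_fun point = point.
Proof.
have -> : point = wedge_inr K point :> wedge_sum K L by [].
by rewrite wedge_map_inr bmap_point.
Qed.

Definition wedge_map : bmap (wedge_sum K L) (wedge_sum K' L') := BMap cont pt.
End wedge_map.

Section words.
Variables K A : basedType.

(* The coproduct over d of the powers (K * A)^d. *)
Definition words : Type :=
  {d : nat & kify (prod_topology (fun _ : 'I_d => kify (K * A)%type))}.
HB.instance Definition _ := KSpace.on words.

Definition letters (w : words) : seq (K * A) :=
  codom (projT2 w : 'I_(projT1 w) -> K * A).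

Definition word_of (s : seq (K * A)) : words :=
  existT _ (size s) (tnth (in_tuple s)).

Lemma word_ofK : cancel word_of letters.
Proof. by move=> s; rewrite /letters /codom /image_mem map_tnth_enum. Qed.
End words.

Lemma kpower_continuous (X : kspaceType) (Y : topologicalType) d
    (f : X -> 'I_d -> Y) :
  (forall i, continuous (f^~ i)) ->
  continuous (f : X -> kify (prod_topology (fun _ : 'I_d => Y))).
Proof.
move=> cf; apply: kify_continuous => x; apply/cvg_sup => i.
move=> B [_ [[C oC <-] Cx] CB]; apply: filterS CB _.
by apply: (cf i x); exact: open_nbhs_nbhs.
Qed.

Lemma kpower_proj (Y : topologicalType) d (i : 'I_d) :
  continuous ((fun f => f i) : kify (prod_topology (fun _ : 'I_d => Y)) -> Y).
Proof.
apply: kify_continuousD.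
exact: (@proj_continuous _ (fun _ : 'I_d => Y) i).
Qed.

Section cat_word.
Variables K A : basedType.
Local Notation W := (words K A).
Local Notation pow d := (kify (prod_topology (fun _ : 'I_d => kify (K * A)%type))).

Definition cat_fun d e (f : pow d) (g : pow e) : pow (d + e)%N :=
  fun i => match fintype.split i with inl j => f j | inr j => g j end.

Definition cat_word (v w : W) : W :=
  existT _ (projT1 v + projT1 w)%N (cat_fun (projT2 v) (projT2 w)).

Lemma letters_cat v w : letters (cat_word v w) = letters v ++ letters w.
Proof.
case: v w => d f [e g]; rewrite /letters /cat_word /= /codom /image_mem.
have -> : enum 'I_(d + e)%N =
    map (@lshift d e) (enum 'I_d) ++ map (@rshift d e) (enum 'I_e).
  have E n : map (@nat_of_ord n) (enum 'I_n) = iota 0 n by exact: val_enum_ord.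
  apply: (inj_map (@ord_inj (d + e)%N)); rewrite map_cat E iotaD; congr cat.
    by rewrite -map_comp -E; apply: eq_map.
  by rewrite -map_comp -[X in iota X _]addn0 iotaDl -E -map_comp; apply: eq_map.
rewrite map_cat; congr cat; rewrite -map_comp; apply: eq_map => i /=.
  by rewrite /cat_fun (unsplitK (inl i)).
by rewrite /cat_fun (unsplitK (inr i)).
Qed.

Let proj_fun d n : pow n -> pow d :=
  match @eqP _ n d with
  | ReflectT e => fun f => ecast m (pow m) e f
  | ReflectF _ => fun _ _ => point
  end.

Let proj_funE d (f : pow d) : @proj_fun d d f = f.
Proof. by rewrite /proj_fun; case: eqP => // e; rewrite eq_axiomK. Qed.

Let proj_fun_continuous d n : continuous (@proj_fun d n).
Proof.
rewrite /proj_fun; case: eqP => [e|_]; last exact: (@cst_continuous (pow n) (pow d) (fun=> point)).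
by case: _ / e => x; exact: cvg_id.
Qed.

Let word_proj d : W -> pow d := fun w => @proj_fun d (projT1 w) (projT2 w).

Let word_proj_continuous d : continuous (@word_proj d).
Proof.
case=> n f; apply: (@sigT_continuous _ _ (pow d) (fun n => @proj_fun d n)).
by move=> m; exact: proj_fun_continuous.
Qed.

Let near_word (T : topologicalType) (u : T -> W) (t : T) :
  continuous u ->
  \forall s \near t,
    u s = existT _ (projT1 (u t)) (@word_proj (projT1 (u t)) (u s)).
Proof.
move=> cu.
have nW : nbhs (u t) [set w : W |
    w = existT _ (projT1 (u t)) (@word_proj (projT1 (u t)) w)].
  case: (u t) => d f /=.
  rewrite /nbhs/= sigT_nbhsE; apply: (@filterE _ (nbhs f)) => g /=.
  by rewrite /word_proj /= proj_funE.
exact: (cu t _ nW).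
Qed.

Lemma cat_word_continuous :
  continuous ((fun p => cat_word p.1 p.2) : kify (W * W)%type -> W).
Proof.
apply: kspace_continuous => C u cC hC cu c.
have c1 : continuous (fst \o u) := compT cu (@kfst_continuous W W).
have c2 : continuous (snd \o u) := compT cu (@ksnd_continuous W W).
pose d := projT1 (u c).1; pose e := projT1 (u c).2.
pose q : kify C -> pow (d + e)%N := fun c' =>
  cat_fun (@word_proj d (u c').1) (@word_proj e (u c').2).
have cq : continuous (q : C -> pow (d + e)%N).
  have ck : continuous (idfun : C -> kify C).
    by apply: kify_test => // x; exact: cvg_id.
  suff cq : continuous q by exact: (compT ck cq).
  apply: kpower_continuous => i; rewrite /q /cat_fun.
  case: (fintype.split i) => j; apply: kify_continuousD.
    exact: (compT (compT c1 (@word_proj_continuous d)) (@kpower_proj _ _ j)).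
  exact: (compT (compT c2 (@word_proj_continuous e)) (@kpower_proj _ _ j)).
have cr : continuous (existT (fun n => pow n) (d + e)%N \o q : C -> W).
  exact: (compT cq (@existT_continuous _ _ _)).
have E : \forall c' \near c,
    existT (fun n => pow n) (d + e)%N (q c') = cat_word (u c').1 (u c').2.
  apply: filterS2 (near_word c c1) (near_word c c2) => c' /= E1 E2.
  by rewrite E1 E2.
have := cr c; rewrite /continuous_at /= (nbhs_singleton E).
by apply: cvg_trans; exact: near_eq_cvg.
Qed.
End cat_word.

(* The congruence on the free monoid on K * A generated by commutativity and the
   relations *^a = *, k^0 = * and k^a1 k^a2 = k^(a1 + a2). *)
Inductive sp_cong (K : basedType) (A : abMonType) :
    seq (K * A) -> seq (K * A) -> Prop :=
| sp_refl s : sp_cong s s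
| sp_sym s t : sp_cong s t -> sp_cong t s
| sp_trans s t u : sp_cong s t -> sp_cong t u -> sp_cong s u
| sp_cat s s' t t' :
    sp_cong s s' -> sp_cong t t' -> sp_cong (s ++ t) (s' ++ t')
| sp_comm s t : sp_cong (s ++ t) (t ++ s)
| sp_base a : sp_cong [:: (point, a)] [::]
| sp_zero k : sp_cong [:: (k, 0)] [::]
| sp_add k a1 a2 : sp_cong [:: (k, a1); (k, a2)] [:: (k, a1 + a2)].

Section SP.
Variables (K : basedType) (A : abMonType).
Local Notation W := (words K A).

Definition sp_rel (v w : W) : bool := `[< sp_cong (letters v) (letters w) >].

Let sp_rel_refl : reflexive sp_rel.
Proof. by move=> w; apply/asboolP; exact: sp_refl. Qed.
Let sp_rel_sym : symmetric sp_rel.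
Proof. by move=> v w; apply/asboolP/asboolP; exact: sp_sym. Qed.
Let sp_rel_trans : transitive sp_rel.
Proof.
by move=> v u w /asboolP uv /asboolP vw; apply/asboolP; exact: sp_trans uv vw.
Qed.
Definition sp_equiv := EquivRel sp_rel sp_rel_refl sp_rel_sym sp_rel_trans.

Definition SP : Type := quotient_topology {eq_quot sp_equiv}.
HB.instance Definition _ := KSpace.on SP.
HB.instance Definition _ := Quotient.on SP.

Definition sp_class (s : seq (K * A)) : SP := \pi_SP (word_of s).
Definition sp_gen (k : K) (a : A) : SP := sp_class [:: (k, a)].

Lemma sp_pi_eq (v w : W) :
  \pi_SP v = \pi_SP w <-> sp_cong (letters v) (letters w).
Proof. by split => [/eqmodP/asboolP|vw]; last by apply/eqmodP/asboolP. Qed.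

Lemma sp_class_eq s t : sp_class s = sp_class t <-> sp_cong s t.
Proof. by rewrite sp_pi_eq !word_ofK. Qed.

Lemma sp_piE w : \pi_SP w = sp_class (letters w).
Proof. by rewrite sp_pi_eq word_ofK; exact: sp_refl. Qed.

Definition sp_letters (x : SP) : seq (K * A) := letters (repr x).

Lemma sp_lettersK : cancel sp_letters sp_class.
Proof. by move=> x; rewrite -sp_piE reprK. Qed.

Lemma sp_class_letters s : sp_cong (sp_letters (sp_class s)) s.
Proof. by rewrite -sp_class_eq sp_lettersK. Qed.

Definition sp_plus (x y : SP) : SP := sp_class (sp_letters x ++ sp_letters y).

Lemma sp_plus_class s t : sp_plus (sp_class s) (sp_class t) = sp_class (s ++ t).
Proof. by apply/sp_class_eq; apply: sp_cat; exact: sp_class_letters. Qed.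

Let sp_plusA : associative sp_plus.
Proof.
move=> x y z; rewrite -[x]sp_lettersK -[y]sp_lettersK -[z]sp_lettersK.
by rewrite !sp_plus_class catA.
Qed.

Let sp_plusC : commutative sp_plus.
Proof. by move=> x y; apply/sp_class_eq; exact: sp_comm. Qed.

Let sp_plus0 : left_id (sp_class [::]) sp_plus.
Proof.
by move=> x; rewrite -[x]sp_lettersK sp_plus_class.
Qed.

HB.instance Definition _ := GRing.isNmodule.Build SP sp_plusA sp_plusC sp_plus0.
HB.instance Definition _ := isPointed.Build SP 0.

Lemma sp_class_cat s t : sp_class (s ++ t) = sp_class s + sp_class t.
Proof. by symmetry; exact: sp_plus_class. Qed.

Let sp_add_continuous :
  continuous ((fun x => x.1 + x.2) : kify (SP * SP)%type -> SP).
Proof.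
apply: (@kprod_quotientl _ _ {eq_quot sp_equiv}); apply: (@kprod_quotientr _ _ {eq_quot sp_equiv}) => /=.
have -> : (fun p : kify (W * W)%type => \pi_SP p.1 + \pi_SP p.2) =
    \pi_SP \o (fun p => cat_word p.1 p.2).
  by apply/funext => -[v w] /=; rewrite !sp_piE letters_cat sp_class_cat.
exact: (compT (@cat_word_continuous K A) (@pi_continuous _ {eq_quot sp_equiv})).
Qed.

HB.instance Definition _ := isAbMonoid.Build SP sp_add_continuous erefl.
End SP.

Section SP_map.
Variables (K K' : basedType) (A A' : abMonType) (g : bmap K K') (f : abmap A A').
Local Notation pow K A d :=
  (kify (prod_topology (fun _ : 'I_d => kify (K * A)%type))).
Let m (x : K * A) : K' * A' := (g x.1, f x.2).

Lemma sp_cong_map s t : sp_cong s t -> sp_cong (map m s) (map m t).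
Proof.
elim=> {s t} [s|s t _|s t u _ st _ tu|s s' t t' _ ss _ tt|s t|a|k|k a1 a2].
- exact: sp_refl.
- exact: sp_sym.
- exact: sp_trans tu.
- by rewrite !map_cat; exact: sp_cat.
- by rewrite !map_cat; exact: sp_comm.
- by rewrite /m /= bmap_point; exact: sp_base.
- by rewrite /m /= (abmap_nmod f).1; exact: sp_zero.
- by rewrite /m /= (abmap_nmod f).2; exact: sp_add.
Qed.

Definition SP_map_fun (x : SP K A) : SP K' A' :=
  sp_class (map m (sp_letters x)).

Lemma SP_map_class s : SP_map_fun (sp_class s) = sp_class (map m s).
Proof. by apply/sp_class_eq/sp_cong_map; exact: sp_class_letters. Qed.

Let SP_map_nmod : nmod_morphism SP_map_fun.
Proof.
split=> [|x y]; first exact: SP_map_class.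
rewrite -[x]sp_lettersK -[y]sp_lettersK -sp_class_cat !SP_map_class.
by rewrite map_cat sp_class_cat.
Qed.

Let word_map (w : words K A) : words K' A' :=
  existT _ (projT1 w) (fun i => m (projT2 w i)).

Let word_map_continuous : continuous word_map.
Proof.
pose E d (h : pow K A d) : words K' A' :=
  existT (fun d => pow K' A' d) d (fun i => m (h i)).
suff cE d : continuous (E d).
  case=> d h.
  exact: (@sigT_continuous nat (fun d => pow K A d) (words K' A') E cE
    (existT _ d h)).
have cp : continuous ((fun h i => m (h i)) : pow K A d -> pow K' A' d).
  apply: kpower_continuous => i.
  apply: (compT (@kpower_proj _ d i)); apply: kpair_continuous.
    exact: (compT (@kfst_continuous _ _) (@bmap_continuous _ _ g)).
  exact: (compT (@ksnd_continuous _ _) (@bmap_continuous _ _ f)).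
exact: (compT cp (@existT_continuous _ (fun d => pow K' A' d) d)).
Qed.

Let SP_map_continuous : continuous SP_map_fun.
Proof.
apply/quotient_continuous.
have -> : SP_map_fun \o \pi_(SP K A) = \pi_(SP K' A') \o word_map.
  apply/funext => w /=; rewrite !sp_piE SP_map_class.
  by rewrite /letters /codom /image_mem -map_comp.
exact: (compT word_map_continuous (@pi_continuous _ {eq_quot sp_equiv K' A'})).
Qed.

Definition SP_map : abmap (SP K A) (SP K' A') :=
  AbMap (abmap_bmap := BMap SP_map_continuous SP_map_nmod.1) SP_map_nmod.
End SP_map.

Definition based_homeo (X Y : basedType) (f : bmap X Y) : Prop :=
  exists2 g : bmap Y X, cancel f g & cancel g f.

Definition ab_iso (A B : abMonType) (f : abmap A B) : Prop :=
  exists2 g : abmap B A, cancel f g & cancel g f.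

(* phi exhibits T as K (x) A: it is a homeomorphism
   Map_Ab(T, B) = Map_T(K, Map_Ab(A, B)), natural in B. *)
Definition is_tensor (K : basedType) (A T : abMonType)
    (phi : forall B : abMonType, bmap (abmap T B) (bmap K (abmap A B))) : Prop :=
  (forall B, based_homeo (phi B)) /\
  (forall (B B' : abMonType) (h : abmap B B') (f : abmap T B) (k : K) (a : A),
     phi B' (abmap_comp h f) k a = h (phi B f k a)).

(* Main.v *)
(* In k-spaces, with the compact-open topology tested on maps from compact
   Hausdorff spaces, X -> Map(Y, Z) is continuous exactly when its adjoint
   X x Y -> Z is: one direction is the tube lemma, the other uses compact
   neighbourhoods in the compact Hausdorff test spaces. Sending f to
   prod k_i^(a_i) |-> sum f(k_i)(a_i) then gives a continuous inverse to the
   restriction of homomorphisms SP(K, A) -> B to the generators, which is (1).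
   In (2)-(4) all maps are built from this universal property, and two
   homomorphisms out of SP(K, A) are equal once they agree on generators. *)
Require Import Defs.
From HB Require Import structures.
From mathcomp Require Import all_boot all_order all_algebra all_classical.
From mathcomp Require Import topology wedge_sigT.

Set Implicit Arguments.
Unset Strict Implicit.
Unset Printing Implicit Defensive.
Import GRing.Theory.
Local Open Scope classical_set_scope.
Local Open Scope quotient_scope.
Local Open Scope ring_scope.

(** * The tube lemma and the exponential law for based k-spaces *)

Lemma open_forall_compact (D C : topologicalType) (O : set (D * C)) :
  compact [set: C] -> open O -> open [set d | forall c, O (d, c)].
Proof.
move=> cC oO; rewrite openE => d /= Od; rewrite /interior.
have := cC; rewrite compact_near_coveringP => /(_ D (nbhs d)
  (fun d' c => O (d', c))) H.
suff : \forall d' \near d, [set: C] `<=` (fun c => O (d', c)).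
  by apply: filterS => d' h c; exact: h.
apply: H => c _.
have : nbhs (d, c) O by apply: open_nbhs_nbhs; split => //; exact: Od.
case=> -[A B] /= [Ad Bc] AB; exists (B, A) => //= -[c' d'] /= [Bc' Ad'].
exact: (AB (d', c')).
Qed.

(** A filter on the subspace is pushed forward to [T], where it clusters at a point of [N]. This
    makes a compact set usable as a test space of its own in the compact-open topology. *)
Lemma compact_set_type (T : topologicalType) (N : set T) :
  compact N -> compact [set: N].
Proof.
move=> cN F PF _.
have FN : ((set_val : N -> T) @ F) N.
  by apply: (@filterE _ F) => x; rewrite set_valE; exact: set_valP.
have [p [Np cp]] := cN _ _ FN.
exists (SigSub (mem_set Np)); split => // A B FA [B' [[V oV VB'] B'p] B'B].
have FA' : ((set_val : N -> T) @ F) (set_val @` A).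
  by apply: (@filterS _ F _ A) => // x Ax; exists x.
have [|_ [[x Ax <-] Vx]] := cp _ V FA'.
  apply: open_nbhs_nbhs; split => //.
  by move: B'p; rewrite -VB'.
by exists x; split => //; apply: B'B; rewrite -VB'.
Qed.

Lemma hausdorff_set_type (T : topologicalType) (N : set T) :
  hausdorff_space T -> hausdorff_space N.
Proof.
move=> hT p q cl; apply: val_inj; apply: hT => U V Up Vq.
have cv : continuous (set_val : N -> T) by exact: initial_continuous.
have [x [Ux Vx]] := cl _ _ (cv p U Up) (cv q V Vq).
by exists (set_val x).
Qed.

Lemma compact_open_continuous (X : topologicalType) (Y Z : basedType)
    (f : X -> compact_open_bmap Y Z) :
  (forall W, @bmap_subbase Y Z W -> open (f @^-1` W)) -> continuous f.
Proof.
move=> ob; apply/continuousP => U [E sE <-].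
rewrite preimage_bigcup; apply: bigcup_open => V EV.
have [F sF <-] := sE _ EV; rewrite openE => x Fx.
rewrite /interior preimage_bigcap; apply: filter_bigI => W FW.
apply: open_nbhs_nbhs; split; last exact: Fx.
by apply: ob; have := sF _ FW; rewrite inE.
Qed.

(** Continuity is tested along [t : D -> X] and against a subbasic set given by [u : C -> Y]. Since
    [D * C] is again compact Hausdorff, [(t, u)] is continuous into the k-ified product, and the
    tube lemma over [C] applies. *)
Lemma bmap_curry_continuous (X : kspaceType) (Y Z : basedType)
    (f : X -> bmap Y Z) :
  continuous ((fun p => f p.1 p.2) : kify (X * Y)%type -> Z) -> continuous f.
Proof.
move=> cf; apply: (@kify_continuous X (compact_open_bmap Y Z)).
apply: kspace_continuous => D t cD hD ct.
apply: compact_open_continuous => W [C [u [V [cC hC cu oV ->]]]].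
apply: (@open_forall_compact D C [set p | V (f (t p.1) (u p.2))]) => //.
have ctu : continuous ((fun p => (t p.1, u p.2)) :
    (D * C)%type -> kify (X * Y)%type).
  apply: kify_test; first by rewrite -setXTT; exact: compact_setX.
    exact: hausdorff_pair.
  apply: pair_continuous.
    by apply: (@compT _ _ _ fst t) => // x; exact: cvg_fst.
  by apply: (@compT _ _ _ snd u) => // x; exact: cvg_snd.
by move/continuousP : (compT ctu cf); exact.
Qed.

(** On a compact Hausdorff test space [D], the point [d0] has a compact neighbourhood [N] on which
    the fixed map [g0] already lands in [V]. Mapping all of [N] into [V] is an open condition on the
    map, so it persists when [g0] varies with [d] near [d0]. *)
Lemma bmap_uncurry_continuous (X : topologicalType) (Y Z : basedType)
    (f : X -> bmap Y Z) :
  continuous f -> continuous ((fun p => f p.1 p.2) : kify (X * Y)%type -> Z).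
Proof.
move=> cf; apply: kspace_continuous => D w cD hD cw.
have ct : continuous (fst \o w) := compT cw (@kfst_continuous X Y).
have cu : continuous (snd \o w) := compT cw (@ksnd_continuous X Y).
apply/continuousP => V oV; rewrite openE => d0 Vd0.
pose g0 := f (w d0).1.
have oS : open [set d | V (g0 (w d).2)].
  by move/continuousP : (compT cu (@bmap_continuous _ _ g0)); exact.
have [N [Nd0 clN NV]] : exists N : set D,
    [/\ nbhs d0 N, closed N & N `<=` [set d | V (g0 (w d).2)]].
  have [] := @compact_regular D d0 setT hD cD filterT [set d | V (g0 (w d).2)].
    exact: open_nbhs_nbhs.
  move=> N Nd0 clNV; exists (closure N).
  split => //; last exact: closed_closure.
  by apply: filterS Nd0; exact: subset_closure.
have cptN : compact N by exact: (subclosed_compact clN cD).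
(* [W] is subbasic: its test space is the subspace [N], mapped to [Y] by the second component of
   [w]. *)
pose W := [set g : bmap Y Z | forall c : N, V (g (w (set_val c)).2)].
have oW : open (W : set (compact_open_bmap Y Z)).
  exists [set W]; last by rewrite bigcup_set1.
  move=> _ ->.
  apply: (@finI_from1 _ _ (@bmap_subbase Y Z) id W).
  exists N, (fun c => (w (set_val c)).2), V; split => //=.
  - exact: (compact_set_type cptN).
  - exact: (@hausdorff_set_type _ N hD).
  - exact: (compT (@initial_continuous _ _ (set_val : N -> D)) cu).
have cf' : continuous ((f : X -> compact_open_bmap Y Z) \o (fst \o w)).
  exact: (compT (compT ct cf) (@kify_id_continuous (compact_open_bmap Y Z))).
have Wd0 : nbhs d0 [set d | W (f (w d).1)].
  move/continuousP : cf' => /(_ _ oW) o1; apply: open_nbhs_nbhs; split => //.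
  by move=> c; apply: NV; rewrite set_valE; exact: set_valP.
apply: filterS (filterI Wd0 Nd0) => d [Wd Nd].
exact: (Wd (SigSub (mem_set Nd))).
Qed.

(** * Extensionality, and currying for spaces of homomorphisms *)

Lemma bmap_ext (X Y : basedType) (f g : bmap X Y) : f =1 g -> f = g.
Proof.
case: f g => [f cf pf] [g cg pg] /= /funext fg; case: _ / fg cg pg => cg pg.
by congr BMap; exact: Prop_irrelevance.
Qed.

Lemma abmap_ext (A B : abMonType) (f g : abmap A B) : f =1 g -> f = g.
Proof.
case: f g => [f nf] [g ng] /= /bmap_ext fg; case: _ / fg ng => ng.
by congr AbMap; exact: Prop_irrelevance.
Qed.

Lemma abmap0 (A B : abMonType) (f : abmap A B) : f 0 = 0.
Proof. exact: (abmap_nmod f).1. Qed.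

Lemma abmapD (A B : abMonType) (f : abmap A B) : {morph f : x y / x + y}.
Proof. exact: (abmap_nmod f).2. Qed.

(** [abmap A B] carries the k-ification of the topology induced from [bmap A B], and a map out of a
    k-space does not see the k-ification, so the case of based maps suffices. *)
Lemma abmap_curry_continuous (X : kspaceType) (A B : abMonType)
    (f : X -> abmap A B) :
  continuous ((fun p => f p.1 p.2) : kify (X * A)%type -> B) -> continuous f.
Proof.
move=> cf.
apply: (@kify_continuous X (initial_topology (@abmap_bmap A B))).
have /continuousP cb : continuous (@abmap_bmap A B \o f).
  exact: (@bmap_curry_continuous X A B (@abmap_bmap A B \o f)).
by apply/continuousP => U [V oV <-]; exact: cb.
Qed.

Lemma abmap_uncurry_continuous (X : topologicalType) (A B : abMonType)
    (f : X -> abmap A B) :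
  continuous f -> continuous ((fun p => f p.1 p.2) : kify (X * A)%type -> B).
Proof.
move=> cf; apply: (@bmap_uncurry_continuous X A B (@abmap_bmap A B \o f)).
pose I := initial_topology (@abmap_bmap A B).
have ci : continuous (@abmap_bmap A B : I -> bmap A B).
  exact: initial_continuous.
exact: (compT cf (@kify_continuousD I _ _ ci)).
Qed.

Lemma sum_continuous (X : kspaceType) (B : abMonType) (I : Type) (r : seq I)
    (F : I -> X -> B) :
  (forall i, continuous (F i)) -> continuous (fun x => \sum_(i <- r) F i x).
Proof.
move=> cF; elim: r => [|i r IH].
  have -> : (fun x : X => \sum_(i <- [::]) F i x) = cst 0.
    by apply/funext => x; rewrite big_nil.
  exact: cst_continuous.
have -> : (fun x => \sum_(j <- i :: r) F j x) =
    (fun p : kify (B * B)%type => p.1 + p.2) \o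
    (fun x => (F i x, \sum_(j <- r) F j x)).
  by apply/funext => x; rewrite big_cons.
exact: (compT (kpair_continuous (cF i) IH) (@kadd_continuous B)).
Qed.

(** * Extension of a based map [K -> Map(A, B)] to a homomorphism on [SP K A] *)

Section SP_lift.
Variables (K : basedType) (A B : abMonType).
Local Notation M := (bmap K (abmap A B)).
Local Notation pow d :=
  (kify (prod_topology (fun _ : 'I_d => kify (K * A)%type))).

Definition word_sum (f : M) (s : seq (K * A)) : B := \sum_(p <- s) f p.1 p.2.

(** The generating relations match properties of the data one by one: [B] is commutative, [f] sends
    the base point to the zero homomorphism, and each [f k] preserves zero and sums. *)
Lemma word_sum_cong (f : M) s t : sp_cong s t -> word_sum f s = word_sum f t.
Proof.
rewrite /word_sum.
elim=> {s t} [//|s t _ -> //|s t u _ -> _ -> //|s s' t t' _ ss _ tt|s t|a|k|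
  k a1 a2].
- by rewrite !big_cat /= ss tt.
- by rewrite !big_cat /= addrC.
- by rewrite big_seq1 big_nil bmap_point /= point0.
- by rewrite big_seq1 big_nil abmap0.
- by rewrite big_cons !big_seq1 /= abmapD.
Qed.

Definition SP_lift_fun (f : M) (x : SP K A) : B := word_sum f (sp_letters x).

Lemma SP_lift_class f s : SP_lift_fun f (sp_class s) = word_sum f s.
Proof. by apply: word_sum_cong; exact: sp_class_letters. Qed.

(** Uncurrying twice: first the identity of [M], then the resulting map into [abmap A B]. *)
Lemma bmap_abmap_eval_continuous :
  continuous ((fun p => p.1.1 p.1.2 p.2) :
    kify (kify (M * K) * A)%type -> B).
Proof.
have c1 : continuous ((fun p => p.1 p.2) : kify (M * K)%type -> abmap A B).
  by apply: (@bmap_uncurry_continuous M K (abmap A B) id) => x; exact: cvg_id.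
exact: (abmap_uncurry_continuous c1).
Qed.

Lemma bmap_abmap_continuous (X : kspaceType) (f : X -> M) (k : X -> K)
    (a : X -> A) :
  continuous f -> continuous k -> continuous a ->
  continuous (fun x => f x (k x) (a x)).
Proof.
move=> cf ck ca.
exact: (compT (kpair_continuous (kpair_continuous cf ck) ca)
  bmap_abmap_eval_continuous).
Qed.

Let word_sum_continuous s : continuous (word_sum^~ s : M -> B).
Proof.
apply: sum_continuous => p; apply: bmap_abmap_continuous.
- by move=> x; exact: cvg_id.
- exact: cst_continuous.
- exact: cst_continuous.
Qed.

Let word_sum_point s : word_sum point s = point.
Proof. by rewrite /word_sum big1 => [|p _] /=; rewrite point0. Qed.

Let word_sum_bmap (s : seq (K * A)) : bmap M B :=
  BMap (@word_sum_continuous s) (word_sum_point s).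

(* Currying the other way round, x |-> (f |-> SP_lift_fun f x), so that
   continuity can be checked on words: no product of quotient maps occurs. *)
Lemma SP_lift_fun_continuous :
  continuous ((fun p => SP_lift_fun p.1 p.2) : kify (M * SP K A)%type -> B).
Proof.
pose F (x : SP K A) : bmap M B := word_sum_bmap (sp_letters x).
suff cF : continuous F.
  exact: (compT (@kswap_continuous M (SP K A)) (bmap_uncurry_continuous cF)).
apply/quotient_continuous.
pose E d (h : pow d) : bmap M B :=
  word_sum_bmap (letters (existT (fun d => pow d) d h)).
have -> : F \o \pi_(SP K A) = (fun w => E (projT1 w) (projT2 w)).
  apply/funext => -[d h]; apply: bmap_ext => f /=.
  by rewrite sp_piE -/(SP_lift_fun f _) SP_lift_class.
suff cE d : continuous (E d).
  case=> d h.
  exact: (@sigT_continuous nat (fun d => pow d) _ E cE (existT _ d h)).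
apply: bmap_curry_continuous => /=.
(* On words of fixed length [d] the index set no longer depends on the word, so the sum is a finite
   sum of continuous functions. *)
have -> : (fun p : kify (pow d * M)%type =>
      word_sum p.2 (letters (existT (fun d => pow d) d p.1))) =
    (fun p => \sum_(i <- enum 'I_d) p.2 (p.1 i).1 (p.1 i).2).
  by apply/funext => -[h f]; rewrite /word_sum /letters big_map.
apply: sum_continuous => i.
have ci : continuous ((fun p => p.1 i) :
    kify (pow d * M)%type -> kify (K * A)%type).
  exact: (compT (@kfst_continuous (pow d) M) (@kpower_proj _ d i)).
apply: bmap_abmap_continuous; first exact: ksnd_continuous.
  exact: (compT ci (@kfst_continuous K A)).
exact: (compT ci (@ksnd_continuous K A)).
Qed.

Let lift_continuous f : continuous (SP_lift_fun f).
Proof.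
have ci : continuous (idfun : SP K A -> SP K A) by move=> x; exact: cvg_id.
have cc : continuous (cst f : SP K A -> M) by exact: cst_continuous.
exact: (compT (kpair_continuous cc ci) SP_lift_fun_continuous).
Qed.

Let lift_nmod f : nmod_morphism (SP_lift_fun f).
Proof.
split=> [|x y]; first by rewrite SP_lift_class /word_sum big_nil.
rewrite -[x]sp_lettersK -[y]sp_lettersK -sp_class_cat !SP_lift_class.
by rewrite /word_sum big_cat.
Qed.

Let lift_point f : SP_lift_fun f point = point.
Proof. by rewrite !point0 (lift_nmod f).1. Qed.

Definition SP_lift (f : M) : abmap (SP K A) B :=
  AbMap (abmap_bmap := BMap (@lift_continuous f) (lift_point f)) (lift_nmod f).

Lemma SP_lift_gen f k a : SP_lift f (sp_gen k a) = f k a.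
Proof. by rewrite /= SP_lift_class /word_sum big_seq1. Qed.

Lemma SP_lift_continuous : continuous SP_lift.
Proof. apply: abmap_curry_continuous; exact: SP_lift_fun_continuous. Qed.

Lemma SP_lift_point : SP_lift point = point.
Proof.
by apply: abmap_ext => x; exact: word_sum_point.
Qed.

Definition SP_lift_bmap : bmap M (abmap (SP K A) B) :=
  BMap SP_lift_continuous SP_lift_point.
End SP_lift.

(** Every element is the class of a word, hence a finite sum of generators. *)
Lemma SP_hom_ext (K : basedType) (A B : abMonType) (f g : abmap (SP K A) B) :
  (forall k a, f (sp_gen k a) = g (sp_gen k a)) -> f =1 g.
Proof.
move=> fg x; rewrite -[x]sp_lettersK.
elim: (sp_letters x) => [|[k a] s IH]; first by rewrite (abmap0 f) (abmap0 g).
by rewrite -cat1s sp_class_cat !abmapD fg IH.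
Qed.

(** * The universal map from [K] to homomorphisms [A -> SP K A] *)

Section sp_gen.
Variables (K : basedType) (A : abMonType).

(** The map factors through the inclusion of the summand of words of length one, followed by the
    quotient map. *)
Lemma sp_gen_continuous :
  continuous ((fun p => sp_gen p.1 p.2) : kify (K * A)%type -> SP K A).
Proof.
pose pow d := kify (prod_topology (fun _ : 'I_d => kify (K * A)%type)).
pose E (p : kify (K * A)%type) : pow 1%N := fun=> p.
have cE : continuous E.
  by apply: kpower_continuous => i x; exact: cvg_id.
have -> : (fun p : kify (K * A)%type => sp_gen p.1 p.2) =
    \pi_(SP K A) \o (existT pow 1%N \o E).
  apply/funext => -[k a] /=; rewrite sp_piE; congr sp_class.
  rewrite /letters /codom /image_mem /= enum_ordSl.
  by rewrite (size0nil (size_enum_ord 0)).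
apply: (@compT _ _ _ _ \pi_(SP K A)); last exact: pi_continuous.
exact: (compT cE (@existT_continuous _ pow 1%N)).
Qed.

Lemma sp_gen_continuous2 (X : kspaceType) (k : X -> K) (a : X -> A) :
  continuous k -> continuous a -> continuous (fun x => sp_gen (k x) (a x)).
Proof.
move=> ck ca; exact: (compT (kpair_continuous ck ca) sp_gen_continuous).
Qed.

Lemma sp_gen_point a : sp_gen point a = 0 :> SP K A.
Proof. by apply/sp_class_eq; exact: sp_base. Qed.

Lemma sp_gen0 k : sp_gen k 0 = 0 :> SP K A.
Proof. by apply/sp_class_eq; exact: sp_zero. Qed.

Lemma sp_genD k a b : sp_gen k (a + b) = sp_gen k a + sp_gen k b :> SP K A.
Proof. by rewrite -sp_class_cat; apply/sp_class_eq/sp_sym; exact: sp_add. Qed.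

Let gen_continuous k : continuous (sp_gen k : A -> SP K A).
Proof.
by apply: sp_gen_continuous2; [exact: cst_continuous | move=> x; exact: cvg_id].
Qed.

Let gen_nmod k : nmod_morphism (sp_gen k : A -> SP K A).
Proof. by split; [exact: sp_gen0 | exact: sp_genD]. Qed.

Let gen_point k : sp_gen k point = point :> SP K A.
Proof. by rewrite !point0 sp_gen0. Qed.

Definition sp_gen_ab (k : K) : abmap A (SP K A) :=
  AbMap (abmap_bmap := BMap (@gen_continuous k) (gen_point k)) (gen_nmod k).

Lemma sp_gen_ab_continuous : continuous sp_gen_ab.
Proof. by apply: abmap_curry_continuous; exact: sp_gen_continuous. Qed.

Lemma sp_gen_ab_point : sp_gen_ab point = point.
Proof. by apply: abmap_ext => a; rewrite /= sp_gen_point point0. Qed.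
End sp_gen.

(** * Functoriality of [SP] *)

Lemma abmap_id_nmod (A : abMonType) : nmod_morphism (bmap_id A).
Proof. by []. Qed.

Definition abmap_id (A : abMonType) : abmap A A := AbMap (@abmap_id_nmod A).

Lemma SP_map_gen (K K' : basedType) (A A' : abMonType) (g : bmap K K')
    (f : abmap A A') k a : SP_map g f (sp_gen k a) = sp_gen (g k) (f a).
Proof. exact: SP_map_class. Qed.

Lemma SP_map_comp (K K' K'' : basedType) (A A' A'' : abMonType)
    (g' : bmap K' K'') (g : bmap K K') (f' : abmap A' A'') (f : abmap A A') x :
  SP_map g' f' (SP_map g f x) = SP_map (bmap_comp g' g) (abmap_comp f' f) x.
Proof.
move: x; apply: (@SP_hom_ext _ _ _ (abmap_comp (SP_map g' f') (SP_map g f))).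
move=> k a; apply: (etrans (congr1 (SP_map g' f') (SP_map_gen g f k a))).
by rewrite !SP_map_gen.
Qed.

Lemma eq_SP_map (K K' : basedType) (A A' : abMonType) (g g' : bmap K K')
    (f f' : abmap A A') :
  g =1 g' -> f =1 f' -> SP_map g f =1 SP_map g' f'.
Proof.
by move=> gg ff; apply: SP_hom_ext => k a; rewrite !SP_map_gen gg ff.
Qed.

Lemma SP_map_id (K : basedType) (A : abMonType) :
  SP_map (bmap_id K) (abmap_id A) =1 id.
Proof.
apply: (@SP_hom_ext _ _ _ _ (abmap_id _)) => k a.
exact: (SP_map_gen (bmap_id K) (abmap_id A)).
Qed.

(** All generators go to generators at the base point, which vanish. This kills the mixed composites
    in the wedge decomposition. *)
Lemma SP_map_cst (K K' : basedType) (A A' : abMonType) (f : abmap A A') x :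
  SP_map (bmap_cst K K') f x = 0.
Proof.
transitivity (point : SP K' A'); last exact: point0.
move: x; apply: (@SP_hom_ext _ _ _ _ point) => k a.
by rewrite SP_map_gen /= sp_gen_point point0.
Qed.

(** * The tensor adjunction *)

Section SP_curry.
Variables (K : basedType) (A B : abMonType).

Definition SP_curry_fun (F : abmap (SP K A) B) (k : K) : abmap A B :=
  abmap_comp F (sp_gen_ab A k).

(** Joint continuity in [F] and [k] gives at once that each [SP_curry F] is continuous and that
    [SP_curry] is. It comes from evaluating [F] at the continuously varying generator. *)
Lemma SP_curry_fun_continuous :
  continuous ((fun p => SP_curry_fun p.1 p.2) :
    kify (abmap (SP K A) B * K)%type -> abmap A B).
Proof.
apply: abmap_curry_continuous.
have cid : continuous (@id (abmap (SP K A) B)) by move=> x; exact: cvg_id.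
pose P := kify (abmap (SP K A) B * K)%type.
have c1 : continuous (fst : kify (P * A)%type -> P) := @kfst_continuous P A.
have cF : continuous ((fun p => p.1.1) :
    kify (P * A)%type -> abmap (SP K A) B) := compT c1 (@kfst_continuous _ K).
have cg : continuous ((fun p => sp_gen p.1.2 p.2) :
    kify (P * A)%type -> SP K A).
  apply: sp_gen_continuous2; first exact: (compT c1 (@ksnd_continuous _ K)).
  exact: ksnd_continuous.
exact: (compT (kpair_continuous cF cg) (abmap_uncurry_continuous cid)).
Qed.

Let curry_continuous F : continuous (SP_curry_fun F).
Proof.
have cc : continuous (cst F : K -> abmap (SP K A) B) by exact: cst_continuous.
have ci : continuous (@id K) by move=> x; exact: cvg_id.
exact: (compT (kpair_continuous cc ci) SP_curry_fun_continuous).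
Qed.

Let curry_point F : SP_curry_fun F point = point.
Proof. by apply: abmap_ext => a /=; rewrite sp_gen_point (abmap0 F) point0. Qed.

Definition SP_curry (F : abmap (SP K A) B) : bmap K (abmap A B) :=
  BMap (@curry_continuous F) (curry_point F).

Let SP_curry_continuous : continuous SP_curry.
Proof. by apply: bmap_curry_continuous; exact: SP_curry_fun_continuous. Qed.

Let SP_curry_point : SP_curry point = point.
Proof. by apply: bmap_ext => k; exact: abmap_ext. Qed.

Definition SP_curry_bmap : bmap (abmap (SP K A) B) (bmap K (abmap A B)) :=
  BMap SP_curry_continuous SP_curry_point.

Lemma SP_curry_homeo : based_homeo SP_curry_bmap.
Proof.
exists (SP_lift_bmap K A B) => [F|f].
  by apply: abmap_ext; apply: SP_hom_ext => k a; rewrite SP_lift_gen.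
by apply: bmap_ext => k; apply: abmap_ext => a; exact: SP_lift_gen.
Qed.
End SP_curry.

(** * The unit: [SP] of the zero-sphere *)

Section SP_S0.
Variable A : abMonType.

Let s0_fun (b : bool) : abmap A A := if b then abmap_id A else point.

Let s0_continuous : continuous s0_fun.
Proof. by apply/continuousP => U _; exact: discrete_open. Qed.

Definition SP_S0 : abmap (SP S0 A) A :=
  SP_lift (BMap s0_continuous erefl : bmap S0 (abmap A A)).

Lemma SP_S0_gen (b : bool) a :
  SP_S0 (sp_gen (b : S0) a) = if b then a else 0.
Proof. by rewrite SP_lift_gen; case: b => //; exact: point0. Qed.

Lemma SP_S0_iso : ab_iso SP_S0.
Proof.
exists (sp_gen_ab A (true : S0)) => [x|a]; last exact: (SP_S0_gen true a).
apply: (@SP_hom_ext _ _ _ (abmap_comp (sp_gen_ab A (true : S0)) SP_S0)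
  (abmap_id _)) => b a.
transitivity (sp_gen (true : S0) (if b then a else 0)).
  by congr sp_gen; exact: SP_S0_gen.
(* At [false], the base point of [S0], both sides are zero: the left as a generator with exponent 0,
   the right as a generator at the base point. *)
by case: b => //; rewrite sp_gen0 -(sp_gen_point S0 a).
Qed.
End SP_S0.

Lemma SP_S0_natural (A A' : abMonType) (f : abmap A A') x :
  SP_S0 A' (SP_map (bmap_id S0) f x) = f (SP_S0 A x).
Proof.
move: x; apply: (@SP_hom_ext _ _ _
  (abmap_comp (SP_S0 A') (SP_map (bmap_id S0) f))
  (abmap_comp f (SP_S0 A))) => b a.
apply: (etrans (congr1 (SP_S0 A') (SP_map_gen _ _ _ _))).
apply: (etrans (SP_S0_gen b (f a))).
apply/esym; apply: (etrans (congr1 f (SP_S0_gen b a))).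
by case: (b) => //; exact: abmap0.
Qed.

(** * Smash products and iterated [SP] *)

Section SP_smash.
Variables (K L : basedType) (A : abMonType).

Let gen2 (k : K) (l : L) : abmap A (SP K (SP L A)) :=
  abmap_comp (sp_gen_ab (SP L A) k) (sp_gen_ab A l).

Let gen2_smash (x : smash K L) : abmap A (SP K (SP L A)) :=
  gen2 (repr x).1 (repr x).2.

(** The choice of representative is harmless because both axes go to zero: a generator at the base
    point vanishes, and so does a generator whose exponent is such a generator. *)
Let gen2_smashE k l : gen2_smash (smash_pair k l) = gen2 k l.
Proof.
apply: abmap_ext => a; rewrite /gen2_smash /smash_pair.
case: piP => -[k' l'] /eqmodP.
rewrite /= /smash_rel /in_axes /= => /predU1P[[-> ->] //|/andP[p q]].
have E k1 l1 : (k1 == point) || (l1 == point) -> gen2 k1 l1 a = 0.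
  by case/orP=> /eqP-> /=; rewrite ?sp_gen_point ?sp_gen0.
exact: (etrans (E _ _ q) (esym (E _ _ p))).
Qed.

Let gen2_smash_continuous : continuous gen2_smash.
Proof.
apply/quotient_continuous.
have -> : gen2_smash \o \pi_(smash K L) = (fun p => gen2 p.1 p.2).
  by apply/funext => -[k l]; exact: gen2_smashE.
apply: abmap_curry_continuous.
pose P := kify (K * L)%type.
have c1 : continuous (fst : kify (P * A)%type -> P) := @kfst_continuous P A.
apply: sp_gen_continuous2; first exact: (compT c1 (@kfst_continuous K L)).
apply: sp_gen_continuous2; first exact: (compT c1 (@ksnd_continuous K L)).
exact: ksnd_continuous.
Qed.

Let gen2_smash_point : gen2_smash point = point.
Proof.
rewrite (gen2_smashE point point); apply: abmap_ext => a /=.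
by rewrite !sp_gen_point.
Qed.

Definition SP_smash : abmap (SP (smash K L) A) (SP K (SP L A)) :=
  SP_lift (BMap gen2_smash_continuous gen2_smash_point).

Lemma SP_smash_gen k l a :
  SP_smash (sp_gen (smash_pair k l) a) = sp_gen k (sp_gen l a).
Proof.
rewrite SP_lift_gen.
exact: (congr1 (fun f : abmap A (SP K (SP L A)) => f a) (gen2_smashE k l)).
Qed.

Let T := SP (smash K L) A.

Let smash_pair_gen (p : kify (K * L)%type) : abmap A T :=
  sp_gen_ab A (smash_pair p.1 p.2).

Let smash_pair_gen_continuous : continuous smash_pair_gen.
Proof.
have cpi : continuous ((fun p => smash_pair p.1 p.2) :
    kify (K * L)%type -> smash K L).
  have -> : (fun p => smash_pair p.1 p.2) = \pi_(smash K L).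
    by apply/funext => -[].
  exact: pi_continuous.
exact: (compT cpi (@sp_gen_ab_continuous (smash K L) A)).
Qed.

Let smash_pair0 k l : (k == point) || (l == point) ->
  smash_pair k l = point :> smash K L.
Proof.
move=> kl; apply/eqmodP; rewrite /= /smash_rel /in_axes /= kl eqxx.
by rewrite orbT.
Qed.

Let inner_continuous k : continuous (fun l : L => smash_pair_gen (k, l)).
Proof.
have cc : continuous (cst k : L -> K) by exact: cst_continuous.
have ci : continuous (@id L) by move=> x; exact: cvg_id.
exact: (compT (kpair_continuous cc ci) smash_pair_gen_continuous).
Qed.

Let inner_point k : smash_pair_gen (k, point) = point.
Proof.
by rewrite /smash_pair_gen smash_pair0 ?eqxx ?orbT // sp_gen_ab_point.
Qed.

Let inner (k : K) : bmap L (abmap A T) :=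
  BMap (@inner_continuous k) (inner_point k).

Let outer_continuous : continuous (fun k : K => SP_lift (inner k)).
Proof.
have ci : continuous inner.
  apply: bmap_curry_continuous => /=.
  have -> : (fun p : kify (K * L)%type => smash_pair_gen (p.1, p.2)) =
      smash_pair_gen by apply/funext => -[].
  exact: smash_pair_gen_continuous.
exact: (compT ci (@SP_lift_continuous L A T)).
Qed.

(** The inverse is built by extending twice: for fixed [k] the map [inner k] extends over [SP L A],
    and the result, as a function of [k], extends over [SP K (SP L A)]. The second extension rests
    on [SP_lift] being continuous in the map it extends. *)
Let outer_point : SP_lift (inner point) = point.
Proof.
apply: abmap_ext; apply: SP_hom_ext => l a; rewrite SP_lift_gen /=.
by rewrite smash_pair0 ?eqxx // sp_gen_point point0.
Qed.

Definition SP_smash_inv : abmap (SP K (SP L A)) T :=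
  SP_lift (BMap outer_continuous outer_point).

Lemma SP_smash_inv_gen k l a :
  SP_smash_inv (sp_gen k (sp_gen l a)) = sp_gen (smash_pair k l) a.
Proof. by rewrite SP_lift_gen; exact: SP_lift_gen. Qed.

Lemma SP_smash_iso : ab_iso SP_smash.
Proof.
exists SP_smash_inv => x.
  apply: (@SP_hom_ext _ _ _ (abmap_comp SP_smash_inv SP_smash) (abmap_id _)).
  move=> y a; have -> : y = smash_pair (repr y).1 (repr y).2.
    by rewrite /smash_pair -surjective_pairing reprK.
  apply: (etrans (congr1 SP_smash_inv (SP_smash_gen _ _ _))).
  exact: SP_smash_inv_gen.
apply: (@SP_hom_ext _ _ _ (abmap_comp SP_smash SP_smash_inv) (abmap_id _)).
(* The exponent [y] is an arbitrary element of [SP L A]. For fixed [k] both sides are homomorphisms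
   in [y], so a second reduction to generators applies. *)
move=> k y; rewrite [LHS]/= [RHS]/=.
apply: (@SP_hom_ext _ _ _
  (abmap_comp (abmap_comp SP_smash SP_smash_inv) (sp_gen_ab (SP L A) k))
  (sp_gen_ab (SP L A) k)) => l a.
apply: (etrans (congr1 SP_smash (SP_smash_inv_gen _ _ _))).
exact: SP_smash_gen.
Qed.
End SP_smash.

Lemma SP_smash_natural (K K' L L' : basedType) (A A' : abMonType)
    (g : bmap K K') (h : bmap L L') (f : abmap A A') x :
  SP_smash K' L' A' (SP_map (smash_map g h) f x) =
  SP_map g (SP_map h f) (SP_smash K L A x).
Proof.
move: x; apply: (@SP_hom_ext _ _ _
  (abmap_comp (SP_smash K' L' A') (SP_map (smash_map g h) f))
  (abmap_comp (SP_map g (SP_map h f)) (SP_smash K L A))) => y a.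
have -> : y = smash_pair (repr y).1 (repr y).2.
  by rewrite /smash_pair -surjective_pairing reprK.
move: (repr y) => [k l] /=; transitivity (sp_gen (g k) (sp_gen (h l) (f a))).
  apply: (etrans (congr1 (SP_smash K' L' A')
    (SP_map_gen (smash_map g h) f (smash_pair k l) a))).
  apply: (etrans (congr1 (fun z => SP_smash K' L' A' (sp_gen z (f a)))
    (smash_map_funE g h k l))).
  exact: SP_smash_gen.
apply/esym.
apply: (etrans (congr1 (SP_map g (SP_map h f)) (SP_smash_gen k l a))).
by rewrite !SP_map_gen.
Qed.

(** * The wedge as a coproduct of based spaces *)

Section wedge_copair.
Variables K L : basedType.

(** The base point of [wedge_sum K L] is by conversion the image of that of [L], so this gluing
    equation also states that the left inclusion is based. *)
Lemma wedge_inl_inr_point :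
  wedge_inl L (point : K) = wedge_inr K (point : L).
Proof.
exact: (@wedge_liftE bool (fun b => if b then K else L : ptopologicalType)
  (fun=> point) false point true point).
Qed.

Definition wedge_inl_bmap : bmap K (wedge_sum K L) :=
  BMap (@wedge_inl_continuous K L) wedge_inl_inr_point.

Definition wedge_inr_bmap : bmap L (wedge_sum K L) :=
  @BMap L (wedge_sum K L) _ (@wedge_inr_continuous K L) erefl.

Lemma wedge_ind (P : wedge_sum K L -> Prop) :
  (forall k, P (wedge_inl L k)) -> (forall l, P (wedge_inr K l)) ->
  forall x, P x.
Proof.
move=> Pl Pr x.
pose X (b : bool) := if b then K else L : ptopologicalType.
have /seteqP[_ /(_ x I)[[] _ [y _ <-]]] := @wedgeTE bool X (fun=> point).
  exact: Pl.
exact: Pr.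
Qed.

Variables (Z : basedType) (g : bmap K Z) (h : bmap L Z).

Let copair_dep (b : bool) : (if b then K else L) -> Z :=
  match b with true => g | false => h end.

Let copair_agree (i j : bool) : @copair_dep i point = @copair_dep j point.
Proof.
by case: i; case: j; rewrite /copair_dep ?(bmap_point g) ?(bmap_point h).
Qed.

Definition wedge_copair_fun : wedge_sum K L -> Z := wedge_fun copair_dep.

Let copair_continuous : continuous wedge_copair_fun.
Proof.
apply: wedge_fun_continuous; last exact: copair_agree.
by case; exact: bmap_continuous.
Qed.

Lemma wedge_copair_inl k : wedge_copair_fun (wedge_inl L k) = g k.
Proof. by rewrite /wedge_copair_fun /wedge_inl wedge_lift_funE. Qed.

Lemma wedge_copair_inr l : wedge_copair_fun (wedge_inr K l) = h l.
Proof. by rewrite /wedge_copair_fun /wedge_inr wedge_lift_funE. Qed.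

Let copair_point : wedge_copair_fun point = point.
Proof. exact: (etrans (wedge_copair_inr point) (bmap_point h)). Qed.

Definition wedge_copair : bmap (wedge_sum K L) Z :=
  BMap copair_continuous copair_point.
End wedge_copair.

(** * [SP] of a wedge as a biproduct *)

Section SP_wedge.
Variables (K L : basedType) (A : abMonType).

(** Projections are induced by collapsing one summand of the wedge, injections by including one;
    together they form biproduct data. *)
Let p1 : abmap (SP (wedge_sum K L) A) (SP K A) :=
  SP_map (wedge_copair (bmap_id K) (bmap_cst L K)) (abmap_id A).
Let p2 : abmap (SP (wedge_sum K L) A) (SP L A) :=
  SP_map (wedge_copair (bmap_cst K L) (bmap_id L)) (abmap_id A).
Let i1 : abmap (SP K A) (SP (wedge_sum K L) A) :=
  SP_map (wedge_inl_bmap K L) (abmap_id A).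
Let i2 : abmap (SP L A) (SP (wedge_sum K L) A) :=
  SP_map (wedge_inr_bmap K L) (abmap_id A).

Local Notation P := (kify (SP K A * SP L A)%type).

Let pair_fun (x : SP (wedge_sum K L) A) : P := (p1 x, p2 x).

Let pair_fun_continuous : continuous pair_fun.
Proof.
exact: (kpair_continuous (@bmap_continuous _ _ p1) (@bmap_continuous _ _ p2)).
Qed.

Let pair_fun_nmod : nmod_morphism pair_fun.
Proof.
split=> [|x y]; first by rewrite /pair_fun (abmap0 p1) (abmap0 p2).
by rewrite /pair_fun (abmapD p1) (abmapD p2).
Qed.

Let pair_fun_point : pair_fun point = point.
Proof. by rewrite /pair_fun !bmap_point. Qed.

Definition SP_wedge : abmap (SP (wedge_sum K L) A) P :=
  AbMap (abmap_bmap := BMap pair_fun_continuous pair_fun_point) pair_fun_nmod.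

Let sum_fun (x : P) : SP (wedge_sum K L) A := i1 x.1 + i2 x.2.

Let sum_fun_continuous : continuous sum_fun.
Proof.
have c1 := compT (@kfst_continuous (SP K A) (SP L A)) (@bmap_continuous _ _ i1).
have c2 := compT (@ksnd_continuous (SP K A) (SP L A)) (@bmap_continuous _ _ i2).
exact: (compT (kpair_continuous c1 c2)
  (@kadd_continuous (SP (wedge_sum K L) A))).
Qed.

Let sum_fun_nmod : nmod_morphism sum_fun.
Proof.
split=> [|x y]; first by rewrite /sum_fun (abmap0 i1) (abmap0 i2) addr0.
by rewrite /sum_fun (abmapD i1) (abmapD i2) addrACA.
Qed.

Let sum_fun_point : sum_fun point = point.
Proof. by rewrite !point0 sum_fun_nmod.1. Qed.

Definition SP_wedge_inv : abmap P (SP (wedge_sum K L) A) :=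
  AbMap (abmap_bmap := BMap sum_fun_continuous sum_fun_point) sum_fun_nmod.

Lemma SP_wedge_inl k a :
  SP_wedge (sp_gen (wedge_inl L k) a) = (sp_gen k a, 0).
Proof.
congr pair; first by rewrite SP_map_gen /= wedge_copair_inl.
by rewrite SP_map_gen /= wedge_copair_inl sp_gen_point.
Qed.

Lemma SP_wedge_inr l a :
  SP_wedge (sp_gen (wedge_inr K l) a) = (0, sp_gen l a).
Proof.
congr pair; last by rewrite SP_map_gen /= wedge_copair_inr.
by rewrite SP_map_gen /= wedge_copair_inr sp_gen_point.
Qed.

Let p1i1 x : p1 (i1 x) = x.
Proof.
rewrite SP_map_comp -[RHS](SP_map_id x).
by apply: eq_SP_map => // k; exact: wedge_copair_inl.
Qed.

Let p1i2 x : p1 (i2 x) = 0.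
Proof.
rewrite SP_map_comp -(@SP_map_cst L K _ _ (abmap_id A) x).
by apply: eq_SP_map => // k; exact: wedge_copair_inr.
Qed.

Let p2i1 x : p2 (i1 x) = 0.
Proof.
rewrite SP_map_comp -(@SP_map_cst K L _ _ (abmap_id A) x).
by apply: eq_SP_map => // k; exact: wedge_copair_inl.
Qed.

Let p2i2 x : p2 (i2 x) = x.
Proof.
rewrite SP_map_comp -[RHS](SP_map_id x).
by apply: eq_SP_map => // k; exact: wedge_copair_inr.
Qed.

(** One composite is checked on generators, each lying in one of the two summands; the other follows
    from the identities for [p1], [p2], [i1], [i2]. *)
Lemma SP_wedge_iso : ab_iso SP_wedge.
Proof.
exists SP_wedge_inv => [x|[x y]].
  apply: (@SP_hom_ext _ _ _ (abmap_comp SP_wedge_inv SP_wedge) (abmap_id _)).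
  elim/wedge_ind=> [k|l] a.
    apply: (etrans (congr1 SP_wedge_inv (SP_wedge_inl k a))).
    apply: (etrans (congr2 +%R (SP_map_gen _ _ _ _) (abmap0 i2))).
    exact: addr0.
  apply: (etrans (congr1 SP_wedge_inv (SP_wedge_inr l a))).
  apply: (etrans (congr2 +%R (abmap0 i1) (SP_map_gen _ _ _ _))).
  exact: add0r.
congr pair.
  by apply: (etrans (abmapD p1 _ _)); rewrite p1i1 p1i2 addr0.
by apply: (etrans (abmapD p2 _ _)); rewrite p2i1 p2i2 add0r.
Qed.
End SP_wedge.

(** By functoriality each component reduces to an equality of based maps out of the wedge, checked
    on the two summands. *)
Lemma SP_wedge_natural (K K' L L' : basedType) (A A' : abMonType)
    (g : bmap K K') (h : bmap L L') (f : abmap A A') x :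
  SP_wedge K' L' A' (SP_map (wedge_map g h) f x) =
  (SP_map g f (SP_wedge K L A x).1, SP_map h f (SP_wedge K L A x).2).
Proof.
congr pair; apply: (etrans (SP_map_comp _ _ _ _ _));
  apply/esym; apply: (etrans (SP_map_comp _ _ _ _ _)); apply: eq_SP_map => //.
  elim/wedge_ind=> [k|l] /=.
    by rewrite wedge_map_inl !wedge_copair_inl.
  by rewrite wedge_map_inr !wedge_copair_inr /= bmap_point.
elim/wedge_ind=> [k|l] /=.
  by rewrite wedge_map_inl !wedge_copair_inl /= bmap_point.
by rewrite wedge_map_inr !wedge_copair_inr.
Qed.
Theorem proposition2p2 :
  (* (1) SP(K, A) = K (x) A, naturally in K and A *)
  (exists phi : forall (K : basedType) (A B : abMonType),
       bmap (abmap (SP K A) B) (bmap K (abmap A B)),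
     [/\ forall (K : basedType) (A : abMonType),
           @is_tensor K A (SP K A) (phi K A),
         forall (K K' : basedType) (A A' B : abMonType)
           (g : bmap K K') (f : abmap A A') (F : abmap (SP K' A') B)
           (k : K) (a : A),
           phi K A B (abmap_comp F (SP_map g f)) k a = phi K' A' B F (g k) (f a)
       & forall (K : basedType) (A B : abMonType) (F : abmap (SP K A) B)
           (k : K) (a : A),
           phi K A B F k a = F (sp_gen k a)]) /\
  (* (2) SP(S^0, A) = A *)
  (exists phi : forall A : abMonType, abmap (SP S0 A) A,
     [/\ forall A : abMonType, ab_iso (phi A),
         forall (A A' : abMonType) (f : abmap A A') (x : SP S0 A),
           phi A' (SP_map (bmap_id S0) f x) = f (phi A x)
       & forall (A : abMonType) (a : A), phi A (sp_gen (true : S0) a) = a]) /\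
  (* (3) SP(K /\ L, A) = SP(K, SP(L, A)) *)
  (exists phi : forall (K L : basedType) (A : abMonType),
       abmap (SP (smash K L) A) (SP K (SP L A)),
     [/\ forall (K L : basedType) (A : abMonType), ab_iso (phi K L A),
         forall (K K' L L' : basedType) (A A' : abMonType)
           (g : bmap K K') (h : bmap L L') (f : abmap A A')
           (x : SP (smash K L) A),
           phi K' L' A' (SP_map (smash_map g h) f x) =
           SP_map g (SP_map h f) (phi K L A x)
       & forall (K L : basedType) (A : abMonType) (k : K) (l : L) (a : A),
           phi K L A (sp_gen (smash_pair k l) a) = sp_gen k (sp_gen l a)]) /\
  (* (4) SP(K \/ L, A) = SP(K, A) x SP(L, A) *)
  (exists phi : forall (K L : basedType) (A : abMonType),
       abmap (SP (wedge_sum K L) A) (kify (SP K A * SP L A)%type),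
     [/\ forall (K L : basedType) (A : abMonType), ab_iso (phi K L A),
         forall (K K' L L' : basedType) (A A' : abMonType)
           (g : bmap K K') (h : bmap L L') (f : abmap A A')
           (x : SP (wedge_sum K L) A),
           phi K' L' A' (SP_map (wedge_map g h) f x) =
           (SP_map g f (phi K L A x).1, SP_map h f (phi K L A x).2),
         forall (K L : basedType) (A : abMonType) (k : K) (a : A),
           phi K L A (sp_gen (wedge_inl L k) a) = (sp_gen k a, 0)
       & forall (K L : basedType) (A : abMonType) (l : L) (a : A),
           phi K L A (sp_gen (wedge_inr K l) a) = (0, sp_gen l a)]).

Proof.
split; [|split; [|split]].
(* The value at [k] and [a] is by computation [F] at the generator, so the formula on generators and
   the naturality in [B] hold by conversion. *)
- exists SP_curry_bmap; split => //.
    move=> K A; split; first exact: SP_curry_homeo.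
    by [].
  move=> K K' A A' B g f F k a.
  exact: (congr1 F (SP_map_gen g f k a)).
- exists SP_S0; split; [exact: SP_S0_iso|exact: SP_S0_natural|].
  by move=> A a; exact: (SP_S0_gen true a).
- exists SP_smash; split;
    [exact: SP_smash_iso|exact: SP_smash_natural|exact: SP_smash_gen].
- exists SP_wedge; split;
    [exact: SP_wedge_iso|exact: SP_wedge_natural|
     exact: SP_wedge_inl|exact: SP_wedge_inr].
Qed.
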